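(* Let $\mathsf{p}$ be an arbitrary probability distribution on $[0,1]^d$, and let $x_1,\dots,x_T$ be sampled i.i.d. from $\mathsf{p}$ and revealed one at a time. There is an online algorithm selecting signs $\chi_t\in\{\pm1\}$ such that, with high probability, for every axis-parallel box $B\subseteq[0,1]^d$ we have $\max_{t\in[T]} \mathsf{disc}_t(B) = O_d(\log^{d+4} T)$.
   Context: An axis-parallel box is a set $B=I_1\times\cdots\times I_d$ with each $I_i\subseteq[0,1]$ an interval. For signs $\chi_1,\dots,\chi_t$, $\mathsf{disc}_t(B):=\big|\sum_{\tau=1}^t \chi_\tau \mathbf{1}_B(x_\tau)\big|$, where $\mathbf{1}_B$ is the indicator of $B$. The algorithm is online: $\chi_t$ is chosen irrevocably upon the arrival of $x_t$, using only $x_1,\dots,x_t$, earlier choices, knowledge of $\mathsf{p}$, and possibly internal randomness. $O_d(\cdot)$ hides a constant depending only on $d$; ''with high probability'' refers to the randomness of inputs and algorithm. *)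

(* Defs.v *)
From HB Require Import structures.
From mathcomp Require Import all_boot all_order all_algebra.
From mathcomp Require Import all_classical all_reals all_analysis.
Set Implicit Arguments.
Unset Strict Implicit.
Unset Printing Implicit Defensive.
Import Order.TTheory GRing.Theory Num.Theory.
Local Open Scope classical_set_scope.
Local Open Scope ring_scope.

(* Points of R^d are d-tuples: n.-tuple carries the product sigma-algebra,
   which on d.-tuple R is the Borel one. *)

Definition unit_cube (R : realType) (d : nat) : set (d.-tuple R) :=
  [set x | forall i, `[0, 1]%classic (tnth x i)].

Definition axis_box (R : realType) (d : nat) (I : 'I_d -> set R) :
  set (d.-tuple R) := [set x | forall i, I i (tnth x i)].

Definition is_axis_box (R : realType) (d : nat) (B : set (d.-tuple R)) : Prop :=
  exists I : 'I_d -> set R,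
    (forall i, is_interval (I i) /\ I i `<=` `[0, 1]%classic) /\
    B = axis_box I.

(* [decide s xs] is the sign bit issued upon arrival of the last point of
   [xs], the list of all points revealed so far in order of arrival. The seed
   [s] carries the internal randomness. Earlier choices are not an argument
   because they are functions of [s] and of the prefixes of [xs]. *)
Record online_algorithm (dS dX : measure_display)
    (S : measurableType dS) (X : measurableType dX) := OnlineAlgorithm {
  decide : S -> seq X -> bool ;
  measurable_decide : forall t : nat,
    measurable_fun [set: S * t.-tuple X]
      (fun sx : S * t.-tuple X => decide sx.1 (tval sx.2)) }.

Section Discrepancy.
Context (R : realType) (dS : measure_display) (S : measurableType dS).
Context (d T : nat) (A : online_algorithm S (d.-tuple R)).
Implicit Types (s : S) (x : T.-tuple (d.-tuple R)) (B : set (d.-tuple R)).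

(* Indices start at 0: [chi s x tau] is the sign of the (tau+1)-st point. *)
Definition chi s x (tau : nat) : R := (-1) ^+ decide A s (take tau.+1 x).

Definition disc s x (t : nat) B : R :=
  `| \sum_(tau < T | (tau < t)%N) chi s x tau * \1_B (tnth x tau) |.

(* Since disc >= 0, the default value 0 of the maximum is harmless. *)
Definition max_disc s x B : R :=
  \big[Num.max/0]_(1 <= t < T.+1) disc s x t B.

End Discrepancy.

Section Sampling.
Local Open Scope ereal_scope.
Context (R : realType) (dO dS dX : measure_display).
Context (Omega : measurableType dO) (P : probability Omega R).
Context (S : measurableType dS) (X : measurableType dX).

Definition has_law (dY : measure_display) (Y : measurableType dY)
    (f : Omega -> Y) (q : probability Y R) : Prop :=
  measurable_fun [set: Omega] f /\
  forall D : set Y, measurable D -> P (f @^-1` D) = q D.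

(* Mutual independence of the family (u, x_0, ..., x_{T-1}); the product rule
   for subfamilies is obtained by taking some of the sets to be the full set. *)
Definition mutually_independent (T : nat) (u : Omega -> S)
    (x : 'I_T -> Omega -> X) : Prop :=
  forall (D : set S) (F : 'I_T -> set X),
    measurable D -> (forall t, measurable (F t)) ->
    P (u @^-1` D `&` [set w | forall t, F t (x t w)]) =
    P (u @^-1` D) * \prod_(t < T) P (x t @^-1` F t).

End Sampling.

(* Main.v *)
Require Import Defs.
From HB Require Import structures.
From mathcomp Require Import all_boot all_order all_algebra.
From mathcomp Require Import all_classical all_reals all_analysis.
From mathcomp Require Import measurable_realfun ring lra zify.
Set Implicit Arguments.
Unset Strict Implicit.
Unset Printing Implicit Defensive.
Import Order.TTheory GRing.Theory Num.Theory.
Local Open Scope classical_set_scope.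
Local Open Scope ring_scope.

(* Each coordinate is quantized by its distribution function at a resolution
   polynomial in T. With high probability any two distinct coordinate values of
   the sample fall in different quantization levels, so every box cuts out the
   same sample points as a box of cells of an integer grid of side 2^h with
   h = O(log T).
   The vector of a cell has one 0/1 entry for each product of dyadic intervals,
   equal to 1 when the product contains the cell; its squared norm is h^d, and
   the indicator of a grid box is a linear functional th of squared norm at most
   (2h)^d on these vectors. The signs follow the self-balancing walk of Alweiss,
   Liu and Sawhney: if w is the current signed sum and v the new vector, the
   sign is +1 with probability 1/2 - <w, v> / 2c, where c is (2h)^d times a
   large multiple of log T. For a deterministic sequence of vectors, induction
   on time shows that E exp <w, th> <= exp (2 c |th|^2) for small th, because
   the drift replaces th by th - (<th, v> / c) v. A union bound over times and
   grid boxes then bounds all discrepancies by c = O(log^(d+1) T). Since <w, v>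
   is an integer, the signs only need independent uniform digits in base 2c. *)

(** * Self-balancing walk *)

(** Inverting [1 - x <= expR (- x)] gives [expR x <= 1 / (1 - x)], and the quadratic exceeds the
    latter by [x^2 (1 - 2x) / (1 - x)]. *)
Lemma expR_le_quadratic (R : realType) (x : R) :
  x <= 2^-1 -> expR x <= 1 + x + 2 * x ^+ 2.
Proof.
move=> x_le; have x1 : 0 < 1 - x by lra.
have e1 : 1 - x <= expR (- x) by exact: expR_ge1Dx.
have : expR x <= (1 - x)^-1.
  by rewrite -[expR x]invrK -expRN lef_pV2 // posrE ?expR_gt0.
move=> /le_trans; apply; rewrite -div1r ler_pdivrMr //.
have : 0 <= x ^+ 2 * (1 - 2 * x) by apply: mulr_ge0; [exact: sqr_ge0 | lra].
by rewrite (_ : (1 + x + 2 * x ^+ 2) * (1 - x) = 1 + x ^+ 2 * (1 - 2 * x)); [lra | ring].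
Qed.

(** With [m] a power of [q], [b] is the leading base-[q] digit: the newest digit gets averaged while
    the older ones stay fixed in [a]. *)
Lemma sum_nat_digits (V : nmodType) (q m : nat) (F : nat -> V) :
  \sum_(0 <= u < q * m) F u =
  \sum_(0 <= a < m) \sum_(0 <= b < q) F (b * m + a)%N.
Proof.
rewrite big_nat_mul exchange_big /=; apply: eq_bigr => b _.
rewrite -{1}[(b * m)%N]add0n big_addn mulSn addnK.
by apply: eq_bigr => a _; rewrite addnC.
Qed.

Section SelfBalancingWalk.
Variables (Z : Type) (c : nat) (k : Z -> Z -> int).
Hypothesis c_gt0 : (0 < c)%N.

Let q := c.*2.

Let q_gt0 : (0 < q)%N. Proof. by rewrite double_gt0. Qed.

Definition digit (u t : nat) : nat := (u %/ q ^ t) %% q.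

Lemma digit_mod m u t : (t < m)%N -> digit (u %% q ^ m) t = digit u t.
Proof.
by move=> tm; rewrite /digit !modn_divl -!expnS modn_dvdm // dvdn_exp2l.
Qed.

(* With [digit u t] uniform in [0, 2c), the sign is negative with probability
   (c + x) / 2c as long as the integer [x] stays in [-c, c]. *)
Definition flip (u t : nat) (x : int) : bool := c%:Z - x <= (digit u t)%:Z.

(* The lists of arrived points are in reverse order. *)
Fixpoint drift (u : nat) (rs : seq Z) (z : Z) : int :=
  if rs is y :: rs' then
    drift u rs' z + (-1) ^+ flip u (size rs') (drift u rs' y) * k y z
  else 0.

(** While every drift stays in [[-c, c]], [flip] has its intended bias; exponential moments are
    taken over such seeds only. *)
Fixpoint balanced (u : nat) (rs : seq Z) : bool :=
  if rs is y :: rs' then balanced u rs' && (`|drift u rs' y| <= c%:Z) else true.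

Fixpoint walk (R : realType) (u : nat) (rs : seq Z) (f : Z -> R) : R :=
  if rs is y :: rs' then
    walk u rs' f + (-1) ^+ flip u (size rs') (drift u rs' y) * f y
  else 0.

(** The first [m] signs read only the lowest [m] digits of the seed. *)
Lemma drift_mod m u rs z :
  (size rs <= m)%N -> drift (u %% q ^ m) rs z = drift u rs z.
Proof.
elim: rs z => [//|y rs IH] z /= lt_m.
by rewrite !IH ?(ltnW lt_m) // /flip digit_mod.
Qed.

Lemma balanced_mod m u rs :
  (size rs <= m)%N -> balanced (u %% q ^ m) rs = balanced u rs.
Proof.
elim: rs => [//|y rs IH] /= lt_m.
by rewrite IH ?(ltnW lt_m) // drift_mod // ltnW.
Qed.

Section Walk.
Variable R : realType.

Lemma walk_mod m u rs (f : Z -> R) :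
  (size rs <= m)%N -> walk (u %% q ^ m) rs f = walk u rs f.
Proof.
elim: rs => [//|y rs IH] /= lt_m.
by rewrite !IH ?(ltnW lt_m) // /flip digit_mod // drift_mod // ltnW.
Qed.

Lemma walk_drift u rs z :
  walk u rs (fun y => (k y z)%:~R : R) = (drift u rs z)%:~R.
Proof.
by elim: rs => [//|y rs IH] /=; rewrite IH rmorphD rmorphM /= rmorph_sign.
Qed.

Lemma walkD u rs (f g : Z -> R) a :
  walk u rs (fun y => f y + a * g y) = walk u rs f + a * walk u rs g.
Proof.
elim: rs => [|y rs IH] /=; first by rewrite mulr0 addr0.
by rewrite IH; ring.
Qed.

Lemma eq_walk u rs (f g : Z -> R) : f =1 g -> walk u rs f = walk u rs g.
Proof. by move=> fg; elim: rs => [//|y rs IH] /=; rewrite IH fg. Qed.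

(** Digit [t] of [b * q ^ t + u] is [b], so the sign is [+1] for the [c - x] smallest values of [b]
    and [-1] for the other [c + x]. *)
Lemma sum_flip u t (x : int) (A : R) : `|x| <= c%:Z -> (u < q ^ t)%N ->
  \sum_(0 <= b < q) expR ((-1) ^+ flip (b * q ^ t + u) t x * A) =
  (c%:R - x%:~R) * expR A + (c%:R + x%:~R) * expR (- A).
Proof.
move=> x_le ut.
have /andP[x1 x2] : (- c%:Z <= x) && (x <= c%:Z) by rewrite -ler_norml.
have [n xn] : exists n : nat, c%:Z - x = n%:Z.
  by exists `|(c%:Z - x)%R|%N; rewrite gez0_abs // subr_ge0.
have nq : (n <= q)%N by rewrite -lez_nat -xn /q -addnn PoszD lerD2l lerNl.
have cx : c%:R - x%:~R = n%:R :> R.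
  by have := congr1 (fun i : int => i%:~R : R) xn; rewrite rmorphB.
have cx' : c%:R + x%:~R = (q - n)%:R :> R.
  by rewrite natrB // -cx /q -addnn natrD; ring.
have E b : (b < q)%N -> flip (b * q ^ t + u) t x = (n <= b)%N.
  move=> bq; rewrite /flip xn /digit divnMDl ?expn_gt0 ?q_gt0 // divn_small //.
  by rewrite addn0 modn_small // lez_nat.
rewrite (big_cat_nat (n := n)) //= cx cx'; congr (_ + _).
  rewrite (eq_big_nat _ _ (F2 := fun=> expR A)) => [|b /andP[_ bn]].
    by rewrite sumr_const_nat subn0 mulr_natl.
  by rewrite E ?(leq_trans bn) // leqNgt bn expr0 mul1r.
rewrite (eq_big_nat _ _ (F2 := fun=> expR (- A))) => [|b /andP[nb bq]].
  by rewrite sumr_const_nat mulr_natl.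
by rewrite E // nb expr1 mulN1r.
Qed.

(** The quadratic bounds on the two exponentials add up to exactly [q (1 + 2 A^2 - A x / c)], and
    [1 + y <= expR y] finishes. *)
Lemma two_point_mgf (x A : R) : `|x| <= c%:R -> `|A| <= 2^-1 ->
  (c%:R - x) * expR A + (c%:R + x) * expR (- A) <=
  q%:R * expR (2 * A ^+ 2 - A / c%:R * x).
Proof.
rewrite !ler_norml => /andP[x1 x2] /andP[A1 A2].
have c0 : 0 < c%:R :> R by rewrite ltr0n.
have e1 := @expR_le_quadratic R A A2.
have e2 := @expR_le_quadratic R (- A) ltac:(lra).
apply: (@le_trans _ _ (q%:R * (1 + (2 * A ^+ 2 - A / c%:R * x)))); last first.
  by rewrite ler_wpM2l // expR_ge1Dx.
rewrite (_ : q%:R * _ = (c%:R - x) * (1 + A + 2 * A ^+ 2) +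
    (c%:R + x) * (1 + - A + 2 * (- A) ^+ 2)); last first.
  by rewrite /q -addnn natrD; field; rewrite gt_eqF.
by rewrite lerD // ler_wpM2l //; lra.
Qed.

Variables (D : finType) (v : Z -> D -> int).
Hypothesis kE : forall y z, k y z = \sum_i v y i * v z i.

Definition pairing (th : D -> R) (z : Z) : R := \sum_i th i * (v z i)%:~R.
Definition sqnorm (th : D -> R) : R := \sum_i th i ^+ 2.

Variable V : R.
Hypothesis V_gt0 : 0 < V.
Hypothesis V_le : V <= c%:R.
Hypothesis sqnorm_v : forall z, sqnorm (fun i => (v z i)%:~R) <= V.

(** For [b = c] this is the functional left after averaging over the sign of [z]; for [b = V] it
    yields Cauchy-Schwarz. *)
Definition shift_dual (b : R) (th : D -> R) z : D -> R :=
  fun i => th i - pairing th z / b * (v z i)%:~R.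

(** With [A] the pairing, the square expands to [|th|^2 - 2 A^2 / b + (A / b)^2 |v|^2], and
    [|v|^2 <= V <= b]. *)
Lemma sqnorm_shift_dual b th z : V <= b ->
  sqnorm (shift_dual b th z) <= sqnorm th - pairing th z ^+ 2 / b.
Proof.
move=> Vb; have b0 : 0 < b := lt_le_trans V_gt0 Vb.
set A := pairing th z.
have -> : sqnorm (shift_dual b th z) =
    sqnorm th - 2 * (A / b) * A + (A / b) ^+ 2 * sqnorm (fun i => (v z i)%:~R).
  rewrite /sqnorm {2}/A /pairing !mulr_sumr -sumrB -big_split /=.
  by apply: eq_bigr => i _; rewrite /shift_dual -/A; ring.
have : (A / b) ^+ 2 * sqnorm (fun i => (v z i)%:~R) <= (A / b) ^+ 2 * b.
  by rewrite ler_wpM2l ?sqr_ge0 // (le_trans (sqnorm_v z)).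
rewrite (_ : A ^+ 2 / b = (A / b) ^+ 2 * b); last by field; rewrite gt_eqF.
rewrite (_ : 2 * (A / b) * A = 2 * ((A / b) ^+ 2 * b)); last by field; rewrite gt_eqF.
lra.
Qed.

(** Cauchy-Schwarz, from nonnegativity of the shifted squared norm at [b = V]. *)
Lemma pairing_sqr_le th z : pairing th z ^+ 2 <= V * sqnorm th.
Proof.
have /(le_trans _) := @sqnorm_shift_dual V th z (lexx V).
move=> /(_ 0); rewrite subr_ge0 ler_pdivrMr // mulrC; apply.
by apply: sumr_ge0 => i _; exact: sqr_ge0.
Qed.

Lemma pairing_shift_dual b th z y :
  pairing (shift_dual b th z) y = pairing th y + - (pairing th z / b) * (k y z)%:~R.
Proof.
set A := _ / b; rewrite /pairing kE rmorph_sum mulr_sumr -big_split /=.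
by apply: eq_bigr => i _; rewrite /shift_dual -/A rmorphM /=; ring.
Qed.

(* Conditioning on the last sign replaces [th] by its shift away from the last
   vector; the squared norm lost there pays for the variance of that sign. *)
Lemma walk_mgf rs th : V * sqnorm th <= 4^-1 ->
  \sum_(0 <= u < q ^ size rs)
     (balanced u rs)%:R * expR (walk u rs (pairing th)) <=
  (q ^ size rs)%:R * expR (2 * c%:R * sqnorm th).
Proof.
have c0 : 0 < c%:R :> R by rewrite ltr0n.
elim: rs th => [|y rs IH] th small.
  rewrite expn0 big_nat1 /= expR0 !mul1r -expR0 ler_expR.
  by rewrite mulr_ge0 ?mulr_ge0 // sumr_ge0 // => i _; exact: sqr_ge0.
rewrite [size _]/= expnS sum_nat_digits.
set A := pairing th y; set th' := shift_dual c%:R th y.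
(* Cauchy-Schwarz and [small] bring [A] into the range of the quadratic bound. *)
have A_le : `|A| <= 2^-1.
  have : `|A| ^+ 2 <= (2^-1) ^+ 2.
    rewrite real_normK ?num_real // (le_trans (pairing_sqr_le th y)) //.
    by rewrite (le_trans small) // exprVn -natrX.
  by rewrite ler_pXn2r // nnegrE // invr_ge0.
have norm' : sqnorm th' <= sqnorm th - A ^+ 2 / c%:R by exact: sqnorm_shift_dual.
have small' : V * sqnorm th' <= 4^-1.
  rewrite (le_trans _ small) // ler_pM2l // (le_trans norm') // gerBl.
  by rewrite mulr_ge0 ?sqr_ge0 // invr_ge0 ltW.
have := IH _ small'; set S := (X in X <= _) => S_le.
apply: (@le_trans _ _ (q%:R * expR (2 * A ^+ 2) * S)); last first.
  rewrite natrM -!mulrA ler_pM2l ?ltr0n //.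
  apply: (le_trans (ler_wpM2l (expR_ge0 _) S_le)).
  rewrite mulrCA ler_wpM2l // -expRD ler_expR.
  (* The loss [A^2 / c] of squared norm, multiplied by [2 c], cancels the term [2 A^2]. *)
  apply: (@le_trans _ _ (2 * A ^+ 2 + 2 * c%:R * (sqnorm th - A ^+ 2 / c%:R))).
    by rewrite lerD2l ler_wpM2l // mulr_ge0 // ltW.
  by rewrite le_eqVlt; apply/orP; left; apply/eqP; field; rewrite gt_eqF.
rewrite /S mulr_sumr ler_sum_nat // => a /= a_lt.
(* The lower digits [a] fix everything before [y]; only the sign of [y] varies with [b]. *)
have modE b : ((b * q ^ size rs + a) %% q ^ size rs)%N = a.
  by rewrite modnMDl modn_small.
have drE b z : drift (b * q ^ size rs + a) rs z = drift a rs z.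
  by rewrite -(@drift_mod (size rs)) // modE.
under eq_bigr => b _.
  rewrite /= -(@balanced_mod (size rs)) // -(@walk_mod (size rs)) // modE !drE.
  rewrite expRD mulrCA.
  over.
rewrite -mulr_sumr.
have [bal|] := boolP (balanced a rs && (`|drift a rs y| <= c%:Z)); last first.
  move=> _; under eq_bigr do rewrite mul0r.
  by rewrite big1_eq mulr0 !mulr_ge0 // expR_ge0.
have /andP[-> dr_le] := bal.
under eq_bigr do rewrite mul1r.
rewrite sum_flip // mul1r.
have := @two_point_mgf (drift a rs y)%:~R A _ A_le.
rewrite -intr_norm -[c%:R]/((c%:Z)%:~R) ler_int => /(_ dr_le) /= step.
rewrite (le_trans (ler_wpM2l (expR_ge0 _) step)) //.
(* The exponent [- A / c] times the drift is exactly the change of the walk from [th] to [th']. *)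
rewrite /th' (eq_walk _ _ (pairing_shift_dual _ _ _)) -/A.
rewrite walkD walk_drift mulrCA -[leRHS]mulrA ler_pM2l ?ltr0n // -!expRD ler_expR.
by rewrite le_eqVlt; apply/orP; left; apply/eqP; ring.
Qed.

(** Markov's inequality for [expR (l * walk)] with [l = 1 / (4 V)]: the moment exponent is at most
    [l c / 2], half of the value [l c] at the threshold. Seed digits beyond [size rs] only multiply
    the count. *)
Lemma walk_chernoff rs th m : (size rs <= m)%N -> sqnorm th <= V ->
  \sum_(0 <= u < q ^ m)
    (balanced u rs && (c%:R < walk u rs (pairing th)))%:R <=
  (q ^ m)%:R * expR (- (c%:R / (8 * V))) :> R.
Proof.
move=> rs_m th_V; set l := (4 * V)^-1.
have l0 : 0 < l by rewrite invr_gt0 mulr_gt0.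
pose th' i := l * th i.
have th'E : sqnorm th' = l ^+ 2 * sqnorm th.
  by rewrite /sqnorm mulr_sumr; apply: eq_bigr => i _; rewrite exprMn.
have walkE u : walk u rs (pairing th') = l * walk u rs (pairing th).
  have -> : walk u rs (pairing th') = walk u rs (fun y => 0 + l * pairing th y).
    by apply: eq_walk => y; rewrite add0r /pairing mulr_sumr; apply: eq_bigr => i _; rewrite mulrA.
  rewrite walkD [X in X + _](_ : _ = 0) ?add0r //.
  by elim: (rs) => [//|y rs' IH] /=; rewrite IH mulr0 addr0.
have lV : l * V = 4^-1 by rewrite /l; field; rewrite gt_eqF.
have norm' : sqnorm th' <= l / 4.
  by rewrite th'E expr2 -mulrA -lV ler_pM2l // ler_pM2l.
have small : V * sqnorm th' <= 4^-1.
  rewrite (le_trans (ler_wpM2l (ltW V_gt0) norm')) // mulrA [V * l]mulrC lV.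
  lra.
pose F u := (balanced u rs && (c%:R < walk u rs (pairing th)))%:R : R.
have FE u : F u = F (u %% q ^ size rs)%N by rewrite /F balanced_mod // walk_mod.
rewrite -/(F _) -(subnK rs_m) expnD sum_nat_digits.
under eq_big_nat => a /andP[_ a_lt].
  under eq_bigr => b _ do rewrite -/(F _) FE modnMDl modn_small //.
  rewrite sumr_const_nat subn0 -mulr_natl; over.
rewrite -mulr_sumr natrM -mulrA ler_wpM2l //.
have mgf := ler_wpM2r (expR_ge0 (- (l * c%:R))) (walk_mgf rs small).
rewrite mulr_suml in mgf.
apply: (le_trans _ (le_trans mgf _)).
  apply: ler_sum => u _; rewrite /F walkE -mulrA -expRD -mulrBr.
  case: (balanced _ _) => /=; last by rewrite mul0r.
  case: ltP => /= [lt_c|_]; rewrite mul1r ?expR_ge0 //.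
  by rewrite leNgt expR_lt1 -leNgt mulr_ge0 ?(ltW l0) // subr_ge0 ltW.
rewrite -[leLHS]mulrA ler_wpM2l // -expRD ler_expR.
have := ler_wpM2l (mulr_ge0 (ler0n R 2) (ler0n R c)) norm'.
have -> : c%:R / (8 * V) = l * c%:R / 2 by rewrite /l; field; rewrite gt_eqF.
lra.
Qed.

Lemma walk_tail rs th m : (size rs <= m)%N -> sqnorm th <= V ->
  \sum_(0 <= u < q ^ m)
    (balanced u rs && (c%:R < `|walk u rs (pairing th)|))%:R <=
  2 * (q ^ m)%:R * expR (- (c%:R / (8 * V))) :> R.
Proof.
move=> rs_m th_V; pose nth i := - th i.
have nth_V : sqnorm nth <= V.
  by rewrite (le_trans _ th_V) // ler_sum // => i _; rewrite /nth sqrrN.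
have walkN u : walk u rs (pairing nth) = - walk u rs (pairing th).
  elim: (rs) => [|y rs' IH] /=; first by rewrite oppr0.
  rewrite IH opprD -mulrN; congr (_ + _ * _).
  by rewrite /pairing -sumrN; apply: eq_bigr => i _; rewrite mulNr.
rewrite -mulrA mulr_natl mulr2n.
apply: (le_trans _ (lerD (walk_chernoff rs_m th_V) (walk_chernoff rs_m nth_V))).
rewrite -big_split /=; apply: ler_sum => u _.
rewrite walkN lter_normr -natrD ler_nat.
by case: (balanced u rs) (c%:R < walk u rs _) (c%:R < - _) => -[] [].
Qed.

Variables (I : finType) (th : I -> D -> R).
Hypothesis sqnorm_th : forall i, sqnorm (th i) <= V.
Hypothesis th_v : forall z, exists i, forall j, th i j = (v z j)%:~R.

(** As [rs] is in reverse order, [drop j rs] is the history [j] steps earlier. *)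
Definition stable u rs : bool :=
  [forall j : 'I_(size rs).+1, forall i,
     `|walk u (drop j rs) (pairing (th i))| <= c%:R].

(** By [th_v] the vector of the next point is itself a test functional, so the bounds at one time
    control the next drift, and induction on time applies. *)
Lemma bounded_balanced u rs :
  (forall (j : nat) i, (j <= size rs)%N -> balanced u (drop j rs) ->
     `|walk u (drop j rs) (pairing (th i))| <= c%:R) -> balanced u rs.
Proof.
elim: rs => [//|y rs IH] bd /=.
have bal : balanced u rs by apply: IH => j i j_le; exact: (bd j.+1).
rewrite bal /=; have [i iE] := th_v y.
have := bd 1%N i isT; rewrite /= drop0 => /(_ bal).
have kyE z : pairing (th i) z = (k z y)%:~R.
  rewrite /pairing kE rmorph_sum; apply: eq_bigr => j _.
  by rewrite iE -rmorphM mulrC.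
by rewrite (eq_walk _ _ kyE) walk_drift -intr_norm -[c%:R]/((c%:Z)%:~R) ler_int.
Qed.

(** If no bound failed at a balanced time, [bounded_balanced] would make all times balanced and all
    bounds true. Hence tail bounds on balanced seeds suffice. *)
Lemma unstable_ex u rs : ~~ stable u rs ->
  exists (j : 'I_(size rs).+1) (i : I),
    balanced u (drop j rs) && (c%:R < `|walk u (drop j rs) (pairing (th i))|).
Proof.
apply: contraNP => noesc.
have bd (j : nat) i : (j <= size rs)%N -> balanced u (drop j rs) ->
    `|walk u (drop j rs) (pairing (th i))| <= c%:R.
  move=> j_le bal; rewrite leNgt; apply/negP => gt_c; apply: noesc.
  by exists (Ordinal (j_le : (j < (size rs).+1)%N)), i; rewrite bal.
apply/forallP => j; apply/forallP => i; apply: (bd) => //; first by rewrite -ltnS.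
apply: bounded_balanced => j' i' j'_le; rewrite drop_drop; apply: bd.
rewrite -(leq_add2r j) size_drop subnK // in j'_le.
by rewrite -ltnS.
Qed.

Lemma unstable_count rs :
  \sum_(0 <= u < q ^ size rs) (~~ stable u rs)%:R <=
  (size rs).+1%:R * #|I|%:R * 2 * (q ^ size rs)%:R * expR (- (c%:R / (8 * V))) :> R.
Proof.
pose esc u (j : 'I_(size rs).+1) i : R :=
  (balanced u (drop j rs) && (c%:R < `|walk u (drop j rs) (pairing (th i))|))%:R.
apply: (@le_trans _ _ (\sum_(j < (size rs).+1) \sum_i
    \sum_(0 <= u < q ^ size rs) esc u j i)).
  rewrite [leRHS](_ : _ = \sum_(0 <= u < q ^ size rs) \sum_i \sum_j esc u j i);
    last first.
    rewrite exchange_big [RHS]exchange_big; apply: eq_bigr => i _.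
    by rewrite [RHS]exchange_big.
  apply: ler_sum => u _; case: (boolP (stable u rs)) => [_|/unstable_ex[j [i ji]]].
    by rewrite sumr_ge0 // => i _; rewrite sumr_ge0.
  rewrite (bigD1 i) //= (bigD1 j) //= {1}/esc ji -addrA lerDl.
  by rewrite addr_ge0 ?sumr_ge0 // => i' _; rewrite sumr_ge0.
apply: (@le_trans _ _ (\sum_(j < (size rs).+1) \sum_(i : I)
    2 * (q ^ size rs)%:R * expR (- (c%:R / (8 * V))))).
  by apply: ler_sum => j _; apply: ler_sum => i _; apply: walk_tail; rewrite ?size_drop ?leq_subr.
rewrite !sumr_const card_ord -!mulrnA -[_ *+ (_ * _)]mulr_natl natrM.
by rewrite le_eqVlt; apply/orP; left; apply/eqP; ring.
Qed.

End Walk.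
End SelfBalancingWalk.

(** * Dyadic decomposition of grid boxes *)

(* Reading the binary expansion of [M], the interval [0, M) splits into one
   dyadic interval for each nonzero bit. *)
Lemma prefix_dyadic_decomposition (h M z : nat) : (M < 2 ^ h)%N ->
  (\sum_(l < h) (odd (M %/ 2 ^ l) && ((z %/ 2 ^ l).+1 == M %/ 2 ^ l)) =
   (z < M))%N.
Proof.
elim: h M z => [|h IH] M z; first by rewrite big_ord0; lia.
(* The lowest bit contributes when [M] is odd and [z = M - 1]; the other bits see [M] and [z]
   halved. *)
rewrite expnS => M_lt; rewrite big_ord_recl /= !divn1.
under eq_bigr => l _ do rewrite /bump /= add1n expnS !divnMA !divn2.
rewrite IH; last lia.
lia.
Qed.

Section DyadicVectors.
Variables (R : realType) (h d : nat).

(** The pair [(l, j)] stands for [[j 2^l, (j + 1) 2^l)]; giving every level [2 ^ h] slots keeps the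
    index type a product. *)
Definition dyad (z : nat) (e : 'I_h * 'I_(2 ^ h)) : int :=
  (z %/ 2 ^ e.1 == e.2)%N%:R.

(** The pieces of [[0, M)]: for each nonzero bit [l], the interval ending at [M] rounded down to a
    multiple of [2 ^ l]. *)
Definition prefix_dual (M : nat) (e : 'I_h * 'I_(2 ^ h)) : R :=
  (odd (M %/ 2 ^ e.1) && (e.2.+1 == M %/ 2 ^ e.1)%N)%:R.

Definition range_dual (m M : nat) (e : 'I_h * 'I_(2 ^ h)) : R :=
  prefix_dual M e - prefix_dual m e.

(** Exactly one dyadic interval of each level contains [z]. *)
Lemma sum_dyad_dual (F : 'I_h -> nat -> R) (z : nat) : (z < 2 ^ h)%N ->
  \sum_(e : 'I_h * 'I_(2 ^ h)) F e.1 e.2 * (dyad z e)%:~R = \sum_(l < h) F l (z %/ 2 ^ l)%N.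
Proof.
move=> z_lt; rewrite -(pair_bigA _ (fun l j => F l (val j) * (dyad z (l, j))%:~R)) /=.
apply: eq_bigr => l _.
have zl : (z %/ 2 ^ l < 2 ^ h)%N by rewrite (leq_ltn_trans (leq_div _ _)).
rewrite (bigD1 (Ordinal zl)) //= /dyad eqxx mulr1 big1 ?addr0 // => j jne.
rewrite /= (_ : (_ == _) = false) ?mulr0 //.
by apply: contraNF jne => /eqP zj; apply/eqP/val_inj.
Qed.

Lemma sum_prefix_dual (M z : nat) : (z < 2 ^ h)%N -> (M < 2 ^ h)%N ->
  \sum_e prefix_dual M e * (dyad z e)%:~R = (z < M)%N%:R.
Proof.
move=> z_lt M_lt.
rewrite (sum_dyad_dual (fun l j => (odd (M %/ 2 ^ l) && (j.+1 == M %/ 2 ^ l)%N)%:R)) //.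
by rewrite -natr_sum prefix_dyadic_decomposition.
Qed.

Lemma sqnorm_dyad z : (z < 2 ^ h)%N -> \sum_e (dyad z e)%:~R ^+ 2 = h%:R :> R.
Proof.
move=> z_lt; rewrite (eq_bigr (fun e : 'I_h * 'I_(2 ^ h) => 1 * (dyad z e)%:~R)); last first.
  by move=> e _; rewrite /dyad mul1r; case: (_ == _); rewrite ?expr1n ?expr0n.
by rewrite (sum_dyad_dual (fun _ _ => 1)) // sumr_const card_ord.
Qed.

Lemma sum_prefix_dual_le M : \sum_e prefix_dual M e <= h%:R.
Proof.
rewrite -(pair_bigA _ (fun l j => prefix_dual M (l, j))) /=.
apply: (@le_trans _ _ (\sum_(l < h) 1)); last by rewrite sumr_const card_ord.
apply: ler_sum => l _; rewrite /prefix_dual /=.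
have [jlt|jge] := ltnP (M %/ 2 ^ l).-1 (2 ^ h).
  rewrite (bigD1 (Ordinal jlt)) //= big1 ?addr0 ?lern1 ?leq_b1 // => j jne.
  rewrite (_ : (_ == _) = false) ?andbF //.
  by apply: contraNF jne => /eqP jE; apply/eqP/val_inj; rewrite /= -jE.
rewrite big1 ?ler01 // => j _; rewrite (_ : (_ == _) = false) ?andbF //.
by apply/eqP => jE; move: jge; rewrite -jE /= leqNgt ltn_ord.
Qed.

(** The entries are differences of bits, so each square is at most the sum of the two bits, and a
    prefix uses at most one interval per level. *)
Lemma sqnorm_range_dual m M : \sum_e range_dual m M e ^+ 2 <= (2 * h)%N%:R.
Proof.
apply: (@le_trans _ _ (\sum_e (prefix_dual M e + prefix_dual m e))).
  apply: ler_sum => e _; rewrite /range_dual /prefix_dual.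
  by case: (_ && _); case: (_ && _) => /=; lra.
by rewrite big_split /= mul2n -addnn natrD lerD // sum_prefix_dual_le.
Qed.

Definition cell := {ffun 'I_d -> 'I_(2 ^ h)}.
Definition dyadic_box := {ffun 'I_d -> 'I_h * 'I_(2 ^ h)}.

Definition box_vec (z : cell) (e : dyadic_box) : int :=
  \prod_i dyad (z i) (e i).

Definition box_dual (m M : cell) (e : dyadic_box) : R :=
  \prod_i range_dual (m i) (M i) (e i).

Definition kernel (y z : cell) : int := \sum_e box_vec y e * box_vec z e.

(** Both vectors are tensor products, so the sum over [e] factors into one sum per coordinate. *)
Lemma pairing_box_dual m M z :
  pairing box_vec (box_dual m M) z =
  \prod_i ((z i < M i)%N%:R - (z i < m i)%N%:R).
Proof.
rewrite /pairing (eq_bigr (fun e : dyadic_box =>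
    \prod_i (range_dual (m i) (M i) (e i) * (dyad (z i) (e i))%:~R))).
  rewrite -(bigA_distr_bigA (fun i e => range_dual (m i) (M i) e * (dyad (z i) e)%:~R)).
  apply: eq_bigr => i _; rewrite -!sum_prefix_dual // -sumrB.
  by apply: eq_bigr => e _; rewrite -mulrBl.
by move=> e _; rewrite big_split /= rmorph_prod.
Qed.

Lemma sqnorm_box_vec z :
  sqnorm (fun e => (box_vec z e)%:~R : R) <= ((2 * h) ^ d)%N%:R.
Proof.
rewrite /sqnorm (eq_bigr (fun e : dyadic_box => \prod_i (dyad (z i) (e i))%:~R ^+ 2)).
  rewrite -(bigA_distr_bigA (fun i e => (dyad (z i) e)%:~R ^+ 2)).
  rewrite (eq_bigr (fun=> h%:R)) => [|i _]; last exact: sqnorm_dyad.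
  by rewrite prodr_const card_ord natrX lerXn2r ?nnegrE // ler_nat leq_pmull.
by move=> e _; rewrite rmorph_prod /= prodrXl.
Qed.

Lemma sqnorm_box_dual m M : sqnorm (box_dual m M) <= ((2 * h) ^ d)%N%:R.
Proof.
rewrite /sqnorm (eq_bigr (fun e : dyadic_box => \prod_i range_dual (m i) (M i) (e i) ^+ 2)).
  rewrite -(bigA_distr_bigA (fun i e => range_dual (m i) (M i) e ^+ 2)).
  rewrite natrX -[X in _ ^+ X](card_ord d) -prodr_const.
  apply: ler_prod => i _; rewrite sqnorm_range_dual andbT.
  by apply: sumr_ge0 => e _; exact: sqr_ge0.
by move=> e _; rewrite prodrXl.
Qed.

(** The [inl] members are the vectors themselves, which control the drift; the [inr] members are the
    grid boxes to be bounded. *)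
Definition test_vec (i : cell + cell * cell) : dyadic_box -> R :=
  match i with
  | inl z => fun e => (box_vec z e)%:~R
  | inr (m, M) => box_dual m M
  end.

Lemma sqnorm_test_vec i : sqnorm (test_vec i) <= ((2 * h) ^ d)%N%:R.
Proof.
by case: i => [z|[m M]] /=; [exact: sqnorm_box_vec | exact: sqnorm_box_dual].
Qed.

Lemma card_test_vec :
  #|((cell + cell * cell)%type : finType)| = (2 ^ (h * d) + 2 ^ (h * d * 2))%N.
Proof.
by rewrite card_sum card_prod !card_ffun !card_ord -!expnM mulnn -expnM.
Qed.

End DyadicVectors.

(** * Quantile keys *)

(** Prepares continuity of measure. An attained endpoint of [J] is included from the start; an
    endpoint that is not attained is approached by running extremes over the rationals of [J]. *)
Lemma interval_exhaustion (R : realType) (J : set R) (a0 b0 : R) :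
  is_interval J -> J a0 -> J b0 ->
  exists lo hi : nat -> R,
    [/\ forall n, J (lo n) /\ lo n <= a0, forall n, J (hi n) /\ b0 <= hi n,
        {homo lo : m n / (m <= n)%N >-> n <= m},
        {homo hi : m n / (m <= n)%N >-> m <= n} &
        forall x, J x -> exists n, lo n <= x <= hi n].
Proof.
move=> itvJ Ja Jb.
(* [M] is the maximum of [J] if there is one, and [b0] otherwise. *)
have [M [JM bM HM]] : exists M, [/\ J M, b0 <= M &
    forall x, J x -> x <= M \/ exists2 y, J y & x < y].
  have [[M [JM MM]]|noM] := pselect (exists M, J M /\ forall x, J x -> x <= M).
    by exists M; split=> // [|x Jx]; [exact: MM | left; exact: MM].
  exists b0; split=> // x Jx; right; apply: contrapT => nomax.
  apply: noM; exists x; split=> // y Jy; rewrite leNgt; apply/negP => xy.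
  by apply: nomax; exists y.
have [m [Jm ma Hm]] : exists m, [/\ J m, m <= a0 &
    forall x, J x -> m <= x \/ exists2 y, J y & y < x].
  have [[m [Jm mm]]|nom] := pselect (exists m, J m /\ forall x, J x -> m <= x).
    by exists m; split=> // [|x Jx]; [exact: mm | left; exact: mm].
  exists a0; split=> // x Jx; right; apply: contrapT => nomin.
  apply: nom; exists x; split=> // y Jy; rewrite leNgt; apply/negP => xy.
  by apply: nomin; exists y.
(* [s] enumerates the rationals, with [a0] in place of those outside [J]. *)
pose s n := let r : R := ratr (odflt 0 (unpickle n)) in if `[<J r>] then r else a0.
have Js n : J (s n) by rewrite /s; case: asboolP.
pose lo := fix lo n := if n is n'.+1 then Num.min (lo n') (s n') else m.
pose hi := fix hi n := if n is n'.+1 then Num.max (hi n') (s n') else M.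
have rat_s x y : J x -> J y -> x < y -> exists n, x < s n < y.
  move=> Jx Jy /rat_in_itvoo[r]; rewrite in_itv /= => /andP[xr ry].
  exists (pickle r); rewrite /s pickleK /= ifT ?xr //.
  by apply/asboolP; apply: (itvJ x y) => //; rewrite !ltW.
have lo_dec n : lo n.+1 <= lo n by rewrite /= ge_min lexx.
have hi_inc n : hi n <= hi n.+1 by rewrite /= le_max lexx.
have lo_mono : {homo lo : m n / (m <= n)%N >-> n <= m}.
  by apply/nonincreasing_seqP.
have hi_mono : {homo hi : m n / (m <= n)%N >-> m <= n}.
  by apply/nondecreasing_seqP.
exists lo, hi; split=> //.
- move=> n; split; last by rewrite (le_trans (lo_mono 0%N n _)).
  by elim: n => [//|n IH] /=; rewrite /Num.min; case: ifP.
- move=> n; split; last by rewrite (le_trans bM) // (hi_mono 0%N n).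
  by elim: n => [//|n IH] /=; rewrite /Num.max; case: ifP.
- move=> x Jx.
  have [n1 h1] : exists n, lo n <= x.
    have [mx|[y Jy yx]] := Hm x Jx; first by exists 0%N.
    have [n /andP[_ sx]] := rat_s y x Jy Jx yx.
    by exists n.+1; rewrite /= ge_min (ltW sx) orbT.
  have [n2 h2] : exists n, x <= hi n.
    have [xM|[y Jy xy]] := HM x Jx; first by exists 0%N.
    have [n /andP[xs _]] := rat_s x y Jx Jy xy.
    by exists n.+1; rewrite /= le_max (ltW xs) orbT.
  exists (maxn n1 n2); apply/andP; split.
    by rewrite (le_trans (lo_mono n1 _ _)) // leq_maxl.
  by rewrite (le_trans h2) // hi_mono // leq_maxr.
Qed.

Lemma homo_level_interval (R : realType) (kap : R -> nat) (j : nat) :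
  {homo kap : a b / a <= b >-> (a <= b)%N} -> is_interval [set a | kap a = j].
Proof.
move=> mono a b /= ka kb z /andP[az zb]; apply/eqP; rewrite eqn_leq.
by rewrite -{1}kb -ka !mono.
Qed.

Section QuantileKey.
Context (R : realType) (dT : measure_display) (T : measurableType dT).
Variables (P : probability T R) (f : T -> R).
Hypothesis mf : measurable_fun [set: T] f.

Lemma measurable_preimage_interval (J : set R) :
  is_interval J -> measurable [set x | J (f x)].
Proof.
by move=> itvJ; rewrite -[X in measurable X]setTI; apply: mf => //; exact: is_interval_measurable.
Qed.

Lemma fine_probability_le (A B : set T) : measurable A -> measurable B ->
  A `<=` B -> fine (P A) <= fine (P B).
Proof.
by move=> mA mB AB; apply: fine_le; rewrite ?fin_num_measure // le_measure // inE.
Qed.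

Let mle a : measurable [set x | f x <= a].
Proof.
apply: (measurable_preimage_interval (J := [set y | y <= a])) => x y /= _ ya z /andP[_ zy].
exact: le_trans ya.
Qed.

Let mlt a : measurable [set x | f x < a].
Proof.
apply: (measurable_preimage_interval (J := [set y | y < a])) => x y /= _ ya z /andP[_ zy].
exact: le_lt_trans ya.
Qed.

Variable N : nat.
Hypothesis N_gt0 : (0 < N)%N.

(* Two distinct points share both truncations only if the closed interval they
   span is light; the strict version separates an atom from its neighbours. *)
Definition quantile_key (a : R) : nat :=
  Num.truncn (N%:R * fine (P [set x | f x <= a])) +
  Num.truncn (N%:R * fine (P [set x | f x < a])).

Let tr_le (a b : R) : a <= b -> (Num.truncn (N%:R * a) <= Num.truncn (N%:R * b))%N.
Proof. by move=> ab; apply: le_truncn; rewrite ler_wpM2l. Qed.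

Let F_le a b : a <= b -> fine (P [set x | f x <= a]) <= fine (P [set x | f x <= b]).
Proof. by move=> ab; apply: fine_probability_le => // x /= /le_trans; apply. Qed.

Let G_le a b : a <= b -> fine (P [set x | f x < a]) <= fine (P [set x | f x < b]).
Proof. by move=> ab; apply: fine_probability_le => // x /= /lt_le_trans; apply. Qed.

Lemma quantile_key_homo : {homo quantile_key : a b / a <= b >-> (a <= b)%N}.
Proof. by move=> a b ab; rewrite leq_add // tr_le // ?F_le ?G_le. Qed.

Lemma quantile_key_le a : (quantile_key a <= 2 * N)%N.
Proof.
have trN (A : set T) : measurable A -> (Num.truncn (N%:R * fine (P A)) <= N)%N.
  move=> mA; rewrite -[leqRHS](natrK (R := R)) le_truncn //.
  rewrite -[leRHS]mulr1 ler_wpM2l // -(lee_fin (R := R)) fineK ?fin_num_measure //.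
  exact: probability_le1.
by rewrite mul2n -addnn leq_add // trN.
Qed.

(** Let [F] and [G] be the probabilities of [f <= .] and [f < .]. Equal keys force both truncations
    to agree at [a] and [b]; with [F a <= G b], the truncation of [N F(b)] is at most that of
    [N G(a)]. So [N (F b - G a) < 1], and [F b - G a] is the mass of [[a, b]]. *)
Lemma quantile_key_itv a b : a < b -> quantile_key a = quantile_key b ->
  (P [set x | (a <= f x <= b)%R] <= (N%:R^-1)%:E)%E.
Proof.
move=> ab; set j := quantile_key b => kab.
have N0 : 0 < N%:R :> R by rewrite ltr0n.
have FG : fine (P [set x | f x <= a]) <= fine (P [set x | f x < b]).
  by apply: fine_probability_le => // x /= /le_lt_trans; apply.
have := tr_le FG; have := tr_le (F_le (ltW ab)); have := tr_le (G_le (ltW ab)).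
move: kab; rewrite /j /quantile_key => kab h1 h2 h3.
have nat_key (A B A' B' : nat) :
    (A + B = A' + B' -> B <= B' -> A <= A' -> A <= B' -> A' <= B)%N by lia.
have {h1 h2 h3 kab} key : leq (Num.truncn (N%:R * fine (P [set x | f x <= b])))
    (Num.truncn (N%:R * fine (P [set x | f x < a])))
  by exact: nat_key kab h1 h2 h3.
have mab : measurable [set x | a <= f x <= b].
  apply: (measurable_preimage_interval (J := [set y | a <= y <= b])).
  move=> x y /= /andP[ax _] /andP[_ yb] z /andP[xz zy].
  by rewrite (le_trans ax) // (le_trans zy).
have split_b : P [set x | f x <= b] =
    (P [set x | (f x < a)%R] + P [set x | (a <= f x <= b)%R])%E.
  rewrite -measureU //.
    congr (P _); apply/seteqP; split=> x /=.
      by move=> fb; case: (ltP (f x) a) => fa; [left | right; apply/andP].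
    by move=> [fa|/andP[]//]; rewrite ltW // (lt_trans fa).
  by apply/seteqP; split=> x //= -[fa /andP[af _]]; move: fa; rewrite ltNge af.
rewrite -[leLHS]fineK ?fin_num_measure // lee_fin.
have : fine (P [set x | f x <= b]) =
    fine (P [set x | f x < a]) + fine (P [set x | a <= f x <= b]).
  by rewrite split_b fineD ?fin_num_measure.
set Fb := fine _ in key *; set Ga := fine (P [set x | f x < a]) in key *; set X := fine _ => E.
have Ga0 : 0 <= Ga by exact: fine_ge0.
have : N%:R * Fb < (Num.truncn (N%:R * Ga)).+1%:R.
  by rewrite (lt_le_trans (truncnS_gt _)) // ler_nat.
have : (Num.truncn (N%:R * Ga))%:R <= N%:R * Ga by rewrite truncn_le mulr_ge0.
rewrite -natr1 E mulrDr -div1r ler_pdivlMr // [X * _]mulrC; lra.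
Qed.

(** The level is an increasing union of closed intervals around [[a, b]] with both ends in the
    level; each is light, and the bound passes to the limit. *)
Lemma quantile_key_level a b : a < b -> quantile_key a = quantile_key b ->
  (P [set x | quantile_key (f x) = quantile_key a] <= (N%:R^-1)%:E)%E.
Proof.
move=> ab kab; set J := [set y | quantile_key y = quantile_key a].
have itvJ : is_interval J by exact/homo_level_interval/quantile_key_homo.
have [lo [hi [lJ hJ l_mono h_mono ex]]] := interval_exhaustion itvJ (erefl : J a) (esym kab : J b).
pose B n := [set x | lo n <= f x <= hi n].
have mB n : measurable (B n).
  apply: (measurable_preimage_interval (J := [set y | lo n <= y <= hi n])).
  move=> x y /= /andP[ax _] /andP[_ yb] z /andP[xz zy].
  by rewrite (le_trans ax) // (le_trans zy).
have UB : [set x | J (f x)] = \bigcup_n B n.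
  apply/seteqP; split=> x /=; first by move=> /ex[n]; exists n.
  by move=> [n _ ?]; apply: (itvJ (lo n) (hi n)) => //; [case: (lJ n) | case: (hJ n)].
have mU : measurable (\bigcup_n B n) by rewrite -UB; exact: measurable_preimage_interval.
rewrite [X in P X]UB.
have cvgB : P \o B @ \oo --> P (\bigcup_n B n).
  apply: nondecreasing_cvg_mu => // n n' nn'; apply/subsetPset => x /andP[l h].
  by apply/andP; split; [apply: le_trans l; exact: l_mono | apply: (le_trans h); exact: h_mono].
rewrite -(cvg_lim _ cvgB) //; apply: lime_le; first by apply/cvg_ex; exists (P (\bigcup_n B n)).
apply: nearW => n; have [Jl la] := lJ n; have [Jh bh] := hJ n.
apply: quantile_key_itv; last by rewrite Jl Jh.
by rewrite (le_lt_trans la) // (lt_le_trans ab).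
Qed.

End QuantileKey.

(** * Independent samples and finite-valued statistics *)

Section MeasurableLevels.
Context (dT : measure_display) (T : measurableType dT).

(** Measurability of a discrete-valued map, stated without a sigma-algebra on [K]. *)
Definition measurable_levels (K : Type) (g : T -> K) : Prop :=
  forall k, measurable [set w | g w = k].

Lemma measurable_levels_set (K : countType) (g : T -> K) (Q : set K) :
  measurable_levels g -> measurable [set w | Q (g w)].
Proof.
move=> mg.
have -> : [set w | Q (g w)] = \bigcup_k [set w | Q k /\ g w = k].
  apply/seteqP; split=> [w Qw|w [k _ [Qk /= gk]]]; first by exists (g w).
  by rewrite /= gk.
apply: countable_bigcupT_measurable; first exact: countableP.
move=> k; have [Qk|nQk] := pselect (Q k).
  by rewrite (_ : [set _ | _] = [set w | g w = k]) //; apply/seteqP; split=> w //= [].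
by rewrite (_ : [set _ | _] = set0) //; apply/seteqP; split=> w //= [].
Qed.

Lemma measurable_levels_pair (K L : Type) (g : T -> K) (l : T -> L) :
  measurable_levels g -> measurable_levels l ->
  measurable_levels (fun w => (g w, l w)).
Proof.
move=> mg ml [a b].
rewrite (_ : [set _ | _] = [set w | g w = a] `&` [set w | l w = b]).
  exact: measurableI.
by apply/seteqP; split=> w /= [-> ->].
Qed.

Lemma measurable_levels_ffun (I : finType) (K : Type) (g : I -> T -> K) :
  (forall i, measurable_levels (g i)) ->
  measurable_levels (fun w => [ffun i => g i w]).
Proof.
move=> mg k.
rewrite (_ : [set _ | _] = \bigcap_(i in [set: I]) [set w | g i w = k i]).
  by apply: fin_bigcap_measurable => [|i _]; [exact: finite_finset | exact: mg].
apply/seteqP; split=> w /=; first by move=> <- i _ /=; rewrite ffunE.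
by move=> gk; apply/ffunP => i; rewrite ffunE gk.
Qed.

Context (R : realType).

Lemma measure_levels (mu : {measure set T -> \bar R}) (K : finType) (g : T -> K)
    (A : set T) : measurable_levels g -> measurable A ->
  mu A = (\sum_(k : K) mu (A `&` [set w | g w = k]))%E.
Proof.
move=> mg mA.
have {1}-> : A = \bigcup_(k in [set` index_enum K]) (A `&` [set w | g w = k]).
  apply/seteqP; split=> [w Aw|w [k _ []]//].
  by exists (g w) => //=; rewrite mem_index_enum.
rewrite measure_fin_bigcup //.
- by rewrite -fsbig_seq // index_enum_uniq.
- by apply/trivIsetP => i j _ _ ij; apply/seteqP; split=> w //= -[[_ gi] [_ gj]];
    move: ij; rewrite -gi -gj eqxx.
- by move=> k _; exact: measurableI.
Qed.

Lemma measure_exists_le (mu : {measure set T -> \bar R}) (I : finType)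
    (Q : pred I) (F : I -> set T) :
  (forall i, measurable (F i)) ->
  (mu [set w | exists2 i, Q i & F i w] <= \sum_(i | Q i) mu (F i))%E.
Proof.
move=> mF.
have -> : [set w | exists2 i, Q i & F i w] = \big[setU/set0]_(i | Q i) F i.
  rewrite -bigcup_seq_cond; apply/seteqP; split=> w /= [i Qi Fi]; exists i => //=.
    by rewrite mem_index_enum.
  by case/andP: Qi.
elim: (index_enum I) => [|i r IH]; first by rewrite !big_nil measure0.
rewrite !big_cons; case: ifP => // Qi.
apply: (le_trans (measureU2 _ _ _)) => //; first exact: bigsetU_measurable.
by rewrite leeD2l.
Qed.

End MeasurableLevels.

Section UniformSeed.
Context (R : realType) (n : nat).

Let inv_n : {nonneg R} := (n.+1%:R^-1)%:nng.

(** Supported on the [n.+1] values [0, ..., n], so a uniform seed below [q > 0] is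
    [uniform_seed q.-1]. *)
Definition uniform_seed : set nat -> \bar R :=
  mscale inv_n (msum (fun k => \d_k) n.+1).

HB.instance Definition _ := Measure.on uniform_seed.

Lemma uniform_seedE (A : set nat) :
  uniform_seed A = ((\sum_(0 <= k < n.+1) (k \in A)%:R) / n.+1%:R)%:E.
Proof.
rewrite /uniform_seed /mscale /= /msum mulrC EFinM; congr (_ * _)%E.
by rewrite big_mkord -sumEFin; apply: eq_bigr => k _; rewrite /= /dirac indicE.
Qed.

Lemma uniform_seedT : uniform_seed setT = 1%E.
Proof.
rewrite uniform_seedE (eq_bigr (fun=> 1)) => [|k _]; last by rewrite in_setT.
by rewrite sumr_const_nat subn0 divff // pnatr_eq0.
Qed.

HB.instance Definition _ :=
  Measure_isProbability.Build _ _ R uniform_seed uniform_seedT.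

End UniformSeed.

Section IndependentSample.
Context (R : realType) (dO dS dX : measure_display).
Context (Omega : measurableType dO) (P : probability Omega R).
Context (S : measurableType dS) (X : measurableType dX).
Context (PS : probability S R) (p : probability X R) (T : nat).
Context (u : Omega -> S) (x : 'I_T -> Omega -> X).
Hypothesis law_u : has_law P u PS.
Hypothesis law_x : forall t, has_law P (x t) p.
Hypothesis indep : mutually_independent P u x.

Lemma independent_pair (s t : 'I_T) (A : set X) : s != t -> measurable A ->
  P [set w | A (x s w) /\ A (x t w)] = (p A * p A)%E.
Proof.
move=> st mA.
pose F r := if (r == s) || (r == t) then A else setT.
have mF r : measurable (F r) by rewrite /F; case: ifP.
have := indep measurableT mF; rewrite preimage_setT setTI probability_setT mul1e.
rewrite (_ : [set w | forall t, F t (x t w)] = [set w | A (x s w) /\ A (x t w)]).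
  move=> ->; rewrite (bigD1 s) //= (bigD1 t) 1?eq_sym //= big1 => [|r /andP[rs rt]].
    by rewrite /F !eqxx orbT mule1 !(law_x _).2.
  by rewrite /F (negbTE rs) (negbTE rt) preimage_setT probability_setT.
apply/seteqP; split=> w /=.
  by move=> Fw; split; [have := Fw s | have := Fw t]; rewrite /F eqxx ?orbT.
by move=> [As At] r; rewrite /F; case: ifP => // /orP[]/eqP->.
Qed.

Variables (K : finType) (Z : X -> K).
Hypothesis mZ : measurable_levels Z.

Definition sample_levels (w : Omega) : {ffun 'I_T -> K} := [ffun t => Z (x t w)].

Lemma measurable_sample_levels : measurable_levels sample_levels.
Proof.
apply: measurable_levels_ffun => t k.
by have [mx _] := law_x t; rewrite -[X in measurable X]setTI; apply: (mx measurableT [set y | Z y = k]).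
Qed.

Lemma seed_indep_levels (D : set S) (zf : {ffun 'I_T -> K}) : measurable D ->
  P (u @^-1` D `&` [set w | sample_levels w = zf]) =
  (PS D * P [set w | sample_levels w = zf])%E.
Proof.
move=> mD.
have -> : [set w | sample_levels w = zf] =
    [set w | forall t, [set y | Z y = zf t] (x t w)].
  apply/seteqP; split=> w /=; first by move=> <- t; rewrite ffunE.
  by move=> Zw; apply/ffunP => t; rewrite ffunE Zw.
have mF (t : 'I_T) : measurable [set y | Z y = zf t] by exact: mZ.
rewrite (indep mD mF) law_u.2 //; congr (_ * _)%E.
by have := indep measurableT mF; rewrite preimage_setT setTI probability_setT mul1e.
Qed.

(** Given the quantized sample, the seed keeps its law by independence, so a bound valid for every
    fixed [zf] survives averaging. *)
Lemma seed_failure_le (bad : {ffun 'I_T -> K} -> set S) (eps : R) :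
  (forall zf, measurable (bad zf)) ->
  (forall zf, (PS (bad zf) <= eps%:E)%E) ->
  measurable [set w | bad (sample_levels w) (u w)] ->
  (P [set w | bad (sample_levels w) (u w)] <= eps%:E)%E.
Proof.
move=> mbad bad_le mB; have msl := measurable_sample_levels.
rewrite (measure_levels P msl mB).
apply: (@le_trans _ _ (\sum_zf eps%:E * P [set w | sample_levels w = zf]))%E.
  apply: lee_sum => zf _.
  rewrite (_ : _ `&` _ = u @^-1` bad zf `&` [set w | sample_levels w = zf]).
    apply: (@le_trans _ _ (PS (bad zf) * P [set w | sample_levels w = zf])%E).
      by rewrite le_eqVlt; apply/orP; left; apply/eqP; exact: seed_indep_levels.
    by rewrite lee_wpmul2r.
  by apply/seteqP; split=> w /= [B E]; split=> //; move: B; rewrite E.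
have tot : (\sum_zf P [set w | sample_levels w = zf] = 1)%E.
  rewrite -(probability_setT P); apply/esym/(etrans (measure_levels P msl measurableT)).
  by apply: eq_bigr => zf _; rewrite setTI.
by rewrite -ge0_sume_distrr ?tot ?mule1.
Qed.

End IndependentSample.

(** * The online algorithm for boxes *)

Section Collisions.
Context (R : realType) (dO dS dX : measure_display).
Context (Omega : measurableType dO) (P : probability Omega R).
Context (S : measurableType dS) (X : measurableType dX).
Context (p : probability X R) (T : nat).
Context (u : Omega -> S) (x : 'I_T -> Omega -> X).
Hypothesis law_x : forall t, has_law P (x t) p.
Hypothesis indep : mutually_independent P u x.
Variables (I K : finType) (kap : I -> X -> K) (thick : I -> pred K) (delta : R).
Hypothesis mkap : forall i, measurable_levels (kap i).
Hypothesis thick_le : forall i j, thick i j ->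
  (p [set y | kap i y = j] <= delta%:E)%E.

Let measurable_pair s t i j :
  measurable [set w | kap i (x s w) = j /\ kap i (x t w) = j].
Proof.
apply: measurableI.
- have [mx _] := law_x s; rewrite -[X in measurable X]setTI.
  by apply: (mx measurableT [set y | kap i y = j]); exact: mkap.
- have [mx _] := law_x t; rewrite -[X in measurable X]setTI.
  by apply: (mx measurableT [set y | kap i y = j]); exact: mkap.
Qed.

(** By independence this is the sum of [p_j^2] over thick levels, at most [delta] times the sum of
    all [p_j]. *)
Lemma pair_collision_le (s t : 'I_T) i : s != t -> 0 <= delta ->
  (P [set w | exists2 j, thick i j & kap i (x s w) = j /\ kap i (x t w) = j]
    <= delta%:E)%E.
Proof.
move=> st d0.
apply: (le_trans (measure_exists_le P (thick i) (fun j => measurable_pair s t i j))).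
apply: (@le_trans _ _ (\sum_j delta%:E * p [set y | kap i y = j])%E).
  rewrite big_mkcond /=; apply: lee_sum => j _; case: ifP => tj; last first.
    by rewrite mule_ge0 // lee_fin.
  have := independent_pair law_x indep st (@mkap i j) => /= pairE.
  apply: (@le_trans _ _ (p [set y | kap i y = j] * p [set y | kap i y = j])%E).
    by rewrite le_eqVlt; apply/orP; left; apply/eqP; exact: pairE.
  by apply: lee_wpmul2r => //; exact: thick_le.
rewrite -ge0_sume_distrr //.
have tot : (\sum_j p [set y | kap i y = j] = 1)%E.
  rewrite -(probability_setT p); apply/esym/(etrans (measure_levels p (@mkap i) measurableT)).
  by apply: eq_bigr => zf _; rewrite setTI.
by rewrite tot mule1.
Qed.

Definition collision (zs : 'I_T -> I -> K) : bool :=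
  [exists r : 'I_T * 'I_T * I, (r.1.1 != r.1.2) &&
    [exists j, thick r.2 j && ((zs r.1.1 r.2 == j) && (zs r.1.2 r.2 == j))]].

Lemma collision_le : 0 <= delta ->
  (P [set w | collision (fun t i => kap i (x t w))] <=
    ((T * T * #|I|)%:R * delta)%:E)%E.
Proof.
move=> d0.
pose C (r : 'I_T * 'I_T * I) := [set w | exists2 j, thick r.2 j &
  kap r.2 (x r.1.1 w) = j /\ kap r.2 (x r.1.2 w) = j].
have mC r : measurable (C r).
  rewrite (_ : C r = \big[setU/set0]_(j | thick r.2 j)
      [set w | kap r.2 (x r.1.1 w) = j /\ kap r.2 (x r.1.2 w) = j]).
    exact: bigsetU_measurable.
  rewrite -bigcup_seq_cond; apply/seteqP; split=> w /= [j Qj Fj]; exists j => //=.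
    by rewrite mem_index_enum.
  by case/andP: Qj.
have -> : [set w | collision (fun t i => kap i (x t w))] =
    [set w | exists2 r, r.1.1 != r.1.2 & C r w].
  apply/seteqP; split=> w /=.
    move=> /existsP[r /andP[ne /existsP[j /and3P[tj /eqP e1 /eqP e2]]]].
    by exists r => //; exists j.
  move=> [r ne [j tj [e1 e2]]]; apply/existsP; exists r; rewrite ne /=.
  by apply/existsP; exists j; rewrite tj e1 e2 !eqxx.
apply: (le_trans (measure_exists_le P (fun r => r.1.1 != r.1.2) mC)).
apply: (@le_trans _ _ (\sum_(r : 'I_T * 'I_T * I) delta%:E)%E).
  rewrite big_mkcond /=; apply: lee_sum => r _; case: ifP => ne //.
  exact: pair_collision_le.
by rewrite sumEFin sumr_const !card_prod !card_ord mulr_natl.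
Qed.

End Collisions.

(** Take [m] the least key of a sample value in [J] and [M] one above the largest, which fits below
    [n]. Keys strictly between the extremes are in [J] by convexity; an extreme key determines the
    sample value by injectivity. *)
Lemma interval_key_range (R : realType) (T n : nat) (a : 'I_T -> R)
    (kap : R -> nat) (J : set R) :
  {homo kap : x y / x <= y >-> (x <= y)%N} -> (forall y, (kap y).+1 < n)%N ->
  (forall s t, kap (a s) = kap (a t) -> a s = a t) -> is_interval J ->
  exists m M : 'I_n, (m <= M)%N /\
    forall t, J (a t) <-> (m <= kap (a t) < M)%N.
Proof.
move=> kap_homo kap_lt inj itvJ.
have n0 : (0 < n)%N by rewrite (leq_ltn_trans _ (kap_lt 0)).
have [[s0 Js0]|none] := pselect (exists s, J (a s)); last first.
  exists (Ordinal n0), (Ordinal n0); split=> // t; split=> [Jt|//].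
  by case: none; exists t.
have Ps0 : [pred s | `[<J (a s)>]] s0 by apply/asboolP.
case: (arg_minnP (fun s => kap (a s)) Ps0) => s1 /= /asboolP J1 min1.
case: (arg_maxnP (fun s => kap (a s)) Ps0) => s2 /= /asboolP J2 max2.
exists (Ordinal (ltnW (kap_lt (a s1)))), (Ordinal (kap_lt (a s2))) => /=; split.
  by rewrite (leq_trans (min1 s2 _)) //; exact/asboolP.
move=> t; split=> [Jt|/andP[]].
  by rewrite min1 ?ltnS ?max2 //; exact/asboolP.
rewrite leq_eqVlt => /orP[/eqP/inj <- //|lt1].
rewrite ltnS leq_eqVlt => /orP[/eqP/inj -> //|lt2].
apply: (itvJ (a s1) (a s2)) => //.
have lt_of y z : (kap y < kap z)%N -> y <= z.
  by move=> yz; rewrite leNgt; apply/negP => /ltW /kap_homo; rewrite leqNgt yz.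
by rewrite !lt_of.
Qed.

Section BoxAlgorithm.
Context (R : realType) (d N h c : nat) (p : probability (d.-tuple R) R).
Hypothesis N_gt0 : (0 < N)%N.
Hypothesis h_gt : (2 * N + 1 < 2 ^ h)%N.

Definition coord_key (i : 'I_d) : R -> nat :=
  quantile_key p (fun x : d.-tuple R => tnth x i) N.

Lemma coord_key_homo i : {homo coord_key i : a b / a <= b >-> (a <= b)%N}.
Proof. by apply: quantile_key_homo; exact: measurable_tnth. Qed.

Lemma coord_keyS_lt i a : ((coord_key i a).+1 < 2 ^ h)%N.
Proof.
apply: leq_ltn_trans h_gt; rewrite addn1 ltnS.
by apply: quantile_key_le; exact: measurable_tnth.
Qed.

Definition quantize (x : d.-tuple R) : cell h d :=
  [ffun i => Ordinal (ltnW (coord_keyS_lt i (tnth x i)))].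

Lemma measurable_coord_key (i : 'I_d) :
  measurable_levels (fun x : d.-tuple R => quantize x i).
Proof.
move=> k.
rewrite (_ : [set _ | _] = [set x | [set a | coord_key i a = k] (tnth x i)]).
  apply: measurable_preimage_interval; first exact: measurable_tnth.
  exact/homo_level_interval/coord_key_homo.
apply/seteqP; split=> x /=; rewrite ffunE; first by move=> <-.
by move=> kE; apply/val_inj.
Qed.

Lemma measurable_quantize : measurable_levels quantize.
Proof.
move=> k; have := measurable_levels_ffun measurable_coord_key k.
congr measurable; apply/seteqP; split=> x /= <-; apply/ffunP => i.
  by rewrite [RHS]ffunE.
by rewrite [LHS]ffunE.
Qed.

(** After [rev] the newest cell comes first, and the number of earlier ones selects the digit;
    [false] is the default for an empty history. *)
Definition cell_decide (s : nat) (zs : seq (cell h d)) : bool :=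
  if rev zs is y :: rs then flip c s (size rs) (drift c (@kernel h d) s rs y)
  else false.

Definition box_decide (s : nat) (xs : seq (d.-tuple R)) : bool :=
  cell_decide s (map quantize xs).

(** The decision factors through the seed and [t] cells, a countable-valued map with measurable
    levels. *)
Lemma measurable_box_decide (t : nat) :
  measurable_fun [set: nat * t.-tuple (d.-tuple R)]
    (fun sx => box_decide sx.1 (tval sx.2)).
Proof.
move=> _ Y _; rewrite setTI.
pose g (sx : nat * t.-tuple (d.-tuple R)) :=
  (sx.1, [ffun i : 'I_t => quantize (tnth sx.2 i)]).
have mg : measurable_levels g.
  apply: measurable_levels_pair.
    by move=> k; rewrite -[X in measurable X]setTI; apply: (measurable_fst measurableT [set k]).
  apply: measurable_levels_ffun => i k.
  have mi : measurable_fun setT (fun sx : nat * t.-tuple (d.-tuple R) => tnth sx.2 i).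
    by apply: (measurableT_comp (measurable_tnth i)).
  rewrite -[X in measurable X]setTI; apply: (mi measurableT [set y | quantize y = k]).
  exact: measurable_quantize.
have := @measurable_levels_set _ _ _ g
  [set sz : nat * {ffun 'I_t -> cell h d} |
    Y (cell_decide sz.1 [seq sz.2 i | i <- enum 'I_t])] mg.
congr measurable; apply/funext => sx /=; congr (Y _).
rewrite /box_decide; congr (cell_decide _ _).
rewrite -[in RHS](map_tnth_enum sx.2) -[RHS]map_comp.
by apply: eq_map => i; rewrite [LHS]ffunE.
Qed.

Definition box_algorithm : online_algorithm nat (d.-tuple R) :=
  OnlineAlgorithm measurable_box_decide.

Section Sample.
Variables (T : nat) (x : T.-tuple (d.-tuple R)).

(** By induction on [t]: the newest term is the head of the reversed prefix, and the algorithm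
    issues there the sign used by [walk]. *)
Lemma sum_chi_walk (s t : nat) (B : set (d.-tuple R)) (f : cell h d -> R) :
  (t <= T)%N -> (forall tau, \1_B (tnth x tau) = f (quantize (tnth x tau))) ->
  \sum_(tau < T | (tau < t)%N) chi box_algorithm s x tau * \1_B (tnth x tau) =
  walk c (@kernel h d) s (rev (take t (map quantize x))) f.
Proof.
move=> + fE; elim: t => [_|t IH t_lt]; first by rewrite big_pred0 // take0.
rewrite (bigD1 (Ordinal t_lt)) //= addrC.
rewrite (eq_bigl (fun tau : 'I_T => (tau < t)%N)); last first.
  by move=> tau; rewrite ltnS ltn_neqAle andbC.
rewrite IH ?(ltnW t_lt) //.
set z0 := quantize (tnth x (Ordinal t_lt)).
have tE : take t.+1 (map quantize x) = rcons (take t (map quantize x)) z0.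
  rewrite (take_nth z0) ?size_map ?size_tuple //; congr rcons.
  by rewrite (nth_map (tnth x (Ordinal t_lt))) ?size_tuple // /z0 [in RHS](tnth_nth (tnth x (Ordinal t_lt))).
rewrite tE rev_rcons /=; congr (_ + _ * _); last exact: fE.
by rewrite /chi /= /box_decide /cell_decide map_take tE rev_rcons.
Qed.

Hypothesis x_inj : forall i s t,
  coord_key i (tnth (tnth x s) i) = coord_key i (tnth (tnth x t) i) ->
  tnth (tnth x s) i = tnth (tnth x t) i.

Lemma box_cell_range (B : set (d.-tuple R)) : is_axis_box B ->
  exists m M : cell h d, forall tau, \1_B (tnth x tau) =
    pairing (@box_vec h d) (@box_dual R h d m M) (quantize (tnth x tau)).
Proof.
move=> [J [itvJ ->]].
have range i : exists mM : 'I_(2 ^ h) * 'I_(2 ^ h), (mM.1 <= mM.2)%N /\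
    forall t, J i (tnth (tnth x t) i) <->
      (mM.1 <= coord_key i (tnth (tnth x t) i) < mM.2)%N.
  have [m [M [mM rg]]] := interval_key_range (@coord_key_homo i)
    (coord_keyS_lt i) (@x_inj i) (itvJ i).1.
  by exists (m, M).
have [mM mMP] := choice range.
exists [ffun i => (mM i).1], [ffun i => (mM i).2] => tau.
rewrite pairing_box_dual indicE.
have factor i : ((quantize (tnth x tau) i < [ffun i => (mM i).2] i)%N%:R -
    (quantize (tnth x tau) i < [ffun i => (mM i).1] i)%N%:R) =
    `[<J i (tnth (tnth x tau) i)>]%:R :> R.
  rewrite !ffunE /=; have [m_le rg] := mMP i.
  rewrite (asbool_equiv_eq (rg tau)) asboolb.
  (* As [m <= M], the difference of the prefix indicators is the indicator of [[m, M)]. *)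
  case: (leqP (mM i).1) => [ge_m|lt_m]; rewrite ?subr0 //=.
  by rewrite (leq_trans lt_m) // subrr.
rewrite (eq_bigr _ (fun i _ => factor i)).
have [inB|ninB] := boolP (_ \in _).
  rewrite big1 // => i _; rewrite asboolT //.
  by move: inB; rewrite inE; exact.
have [i Ji] : exists i, ~ J i (tnth (tnth x tau) i).
  apply: contrapT => allJ; move/negP: ninB; apply; rewrite inE => i.
  by apply: contrapT => Ji; apply: allJ; exists i.
by rewrite (bigD1 i) //= asboolF // mul0r.
Qed.

Lemma max_disc_le (s : nat) (B : set (d.-tuple R)) : is_axis_box B ->
  stable c (@kernel h d) (@box_vec h d) (@test_vec R h d) s
    (rev (map quantize x)) ->
  max_disc box_algorithm s x B <= c%:R.
Proof.
move=> /box_cell_range[m [M mM]] /forallP st.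
rewrite /max_disc big_nat; apply: bigmax_le => // t /andP[_ t_le].
rewrite /disc (sum_chi_walk s t_le mM).
(* Time [t] is reached by dropping the [T - t] newest points. *)
have j_lt : (T - t < (size (rev (map quantize x))).+1)%N.
  by rewrite size_rev size_map size_tuple ltnS leq_subr.
have /forallP/(_ (inr (m, M))) := st (Ordinal j_lt).
by rewrite /= drop_rev size_map size_tuple subKn.
Qed.

End Sample.

End BoxAlgorithm.

(** * Choice of the parameters *)

(** With [N] the right-hand side, collisions cost at most half of [T^-c]. *)
Lemma collision_budget (T d c tau : nat) : (0 < tau)%N -> (T <= 2 ^ tau)%N ->
  (2 * T ^ c * (T * T * d) <= 2 ^ (d + (c + 3) * tau))%N.
Proof.
move=> tau0 T_le.
have -> : (2 * T ^ c * (T * T * d) = d * (2 * T ^ (c + 2)))%N.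
  by rewrite expnD; ring.
rewrite [leqRHS]expnD leq_mul //; first exact/ltnW/ltn_expl.
apply: (@leq_trans (2 ^ tau * (2 ^ tau) ^ (c + 2))).
  by rewrite leq_mul ?leq_exp2r ?addn2 // -{1}(expn1 2) leq_exp2l.
by rewrite -expnM -expnD leq_exp2l //; nia.
Qed.

(** The union over [T.+1] times, all test functionals and two signs costs the other half of
    [T^-c]. *)
Lemma stability_budget (T b c tau : nat) : (0 < tau)%N -> (T <= 2 ^ tau)%N ->
  (2 * T ^ c * (T.+1 * (2 ^ (b * tau) + 2 ^ (b * tau * 2)) * 2) <=
   2 ^ ((2 * b + c + 6) * tau))%N.
Proof.
move=> tau0 T_le.
have T1 : (T.+1 <= 2 ^ tau.+1)%N.
  by rewrite expnS mul2n -addnn -addn1 leq_add // expn_gt0.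
have s1 : (2 ^ (b * tau) + 2 ^ (b * tau * 2) <= 2 ^ (b * tau * 2).+1)%N.
  by rewrite expnS mul2n -addnn leq_add // leq_exp2l //; lia.
have Tc : (T ^ c <= 2 ^ (tau * c))%N.
  by rewrite expnM; case: (c) => [//|c']; rewrite leq_exp2r.
apply: (@leq_trans (2 * 2 ^ (tau * c) * (2 ^ tau.+1 * 2 ^ (b * tau * 2).+1 * 2))).
  by rewrite !leq_mul.
have -> : (2 * 2 ^ (tau * c) * (2 ^ tau.+1 * 2 ^ (b * tau * 2).+1 * 2) =
    2 ^ (tau * c + tau + b * tau * 2 + 4))%N.
  by rewrite !expnD !expnS expn0; ring.
by rewrite leq_exp2l //; nia.
Qed.

Lemma expRN_natr_le (R : realType) (m : nat) :
  expR (- m%:R) <= (2 ^ m)%N%:R^-1 :> R.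
Proof.
have e2 : 2 <= expR 1 :> R by have := expR_ge1Dx (1 : R); lra.
rewrite expRN -[m%:R]mulr1 expRM_natl natrX lef_pV2 ?posrE ?exprn_gt0 ?expR_gt0 //.
by rewrite lerXn2r ?nnegrE ?expR_ge0.
Qed.

(** From [2 ^ (tau - 1) < T], [tau ln 2 <= ln (2 T) <= 2 ln T]. *)
Lemma up_log_le_ln (R : realType) (T : nat) : (2 <= T)%N ->
  (up_log 2 T)%:R <= 2 / ln 2 * ln (T%:R) :> R.
Proof.
move=> T2; have T0 : 0 < T%:R :> R by rewrite ltr0n (leq_trans _ T2).
have ln2 : 0 < ln 2 :> R by rewrite ln_gt0 // ltr1n.
have lnT : ln 2 <= ln T%:R :> R by rewrite ler_ln ?posrE // ler_nat.
have tau0 : (0 < up_log 2 T)%N by rewrite up_log_gt0.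
have : ln ((2 : R) ^+ (up_log 2 T)) <= ln (2 * T%:R).
  rewrite ler_ln ?posrE ?exprn_gt0 ?mulr_gt0 // -natrX -natrM ler_nat.
  by rewrite -(prednK tau0) expnS leq_mul // ltnW // up_log_gtn.
rewrite lnXn // lnM ?posrE // => le_ln.
rewrite mulrAC ler_pdivlMr // mulr_natl; lra.
Qed.

Theorem theorem1p2 (R : realType) (d : nat) (d_gt0 : (0 < d)%N) (c : nat) :
  exists C : R,
  forall p : probability (d.-tuple R) R, p (@unit_cube R d) = 1%E ->
  forall T : nat, (2 <= T)%N ->
  exists (dS : measure_display) (S : measurableType dS)
    (PS : probability S R) (A : online_algorithm S (d.-tuple R)),
  forall (dO : measure_display) (Omega : measurableType dO)
    (P : probability Omega R)
    (u : Omega -> S) (x : 'I_T -> Omega -> d.-tuple R),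
  has_law P u PS ->
  (forall t, has_law P (x t) p) ->
  mutually_independent P u x ->
  exists E : set Omega,
    [/\ measurable E,
        ((1 - (T%:R ^+ c)^-1)%:E <= P E)%E &
        forall w, E w ->
        forall B : set (d.-tuple R), is_axis_box B ->
          max_disc A (u w) [tuple x t w | t < T] B
            <= C * ln (T%:R) ^+ (d + 4)].
Proof.
(* [a] makes [4 N <= 2 ^ (a tau)]; [b] is the exponent of [stability_budget] at [a * d]. *)
pose a := (d + c + 5)%N; pose b := (2 * (a * d) + c + 6)%N.
exists (((2 * a) ^ d * (8 * b))%N%:R * (2 / ln 2) ^+ (d + 4)) => p _ T T2.
pose tau := up_log 2 T.
have tau0 : (0 < tau)%N by rewrite up_log_gt0.
have T_le : (T <= 2 ^ tau)%N by exact: up_logP.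
pose N := (2 ^ (d + (c + 3) * tau))%N; pose h := (a * tau)%N.
have N0 : (0 < N)%N by rewrite expn_gt0.
have h_gt : (2 * N + 1 < 2 ^ h)%N.
  apply: (@leq_trans (4 * N)); first lia.
  by rewrite -[4%N]/(2 ^ 2)%N -expnD leq_exp2l // /h /a; nia.
(* The choice [cc / (8 V) = b tau] makes the tail at most [2 ^ -(b tau)]. *)
pose V := ((2 * h) ^ d)%N; pose cc := (V * (8 * b * tau))%N.
have V0 : (0 < V)%N by rewrite expn_gt0 /h /a; apply/orP; left; nia.
have cc0 : (0 < cc)%N by rewrite /cc /b; nia.
(* One base-[2 cc] digit for each of the [T] points. *)
pose q := (cc.*2 ^ T)%N.
have q0 : (0 < q)%N by rewrite expn_gt0 double_gt0 cc0.
exists _, nat, (uniform_seed R q.-1), (box_algorithm cc p h_gt).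
move=> dO Omega P u x law_u law_x indep.
pose Z := quantize p h_gt.
pose zw := sample_levels x Z.
pose cells (zf : {ffun 'I_T -> cell h d}) : seq (cell h d) :=
  rev [seq zf t | t <- enum 'I_T].
(* Only levels merging two distinct values matter: an atom alone in its level may be heavy, but
   sharing it is harmless. *)
pose thick (i : 'I_d) (j : 'I_(2 ^ h)) := `[< exists y z,
  [/\ y < z, coord_key N p i y = j & coord_key N p i z = j] >].
pose coll (zf : {ffun 'I_T -> cell h d}) := collision thick (fun t i => zf t i).
pose bad zf : set nat :=
  [set s | ~~ stable cc (@kernel h d) (@box_vec h d) (@test_vec R h d) s (cells zf)].
have mzw : measurable_levels zw.
  by apply: measurable_sample_levels => //; exact: measurable_quantize.
have mpair : measurable_levels (fun w => (u w, zw w)).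
  apply: measurable_levels_pair => // k; have [mu _] := law_u.
  by rewrite -[X in measurable X]setTI; apply: (mu measurableT [set k]).
pose Coll := [set w | coll (zw w)].
pose Unst := [set w | bad (zw w) (u w)].
have mColl : measurable Coll.
  exact: (measurable_levels_set (fun zf => coll zf : Prop) mzw).
have mUnst : measurable Unst.
  exact: (measurable_levels_set (fun sz : nat * {ffun 'I_T -> cell h d} => bad sz.2 sz.1) mpair).
have Coll_le : (P Coll <= ((T * T * d)%:R * N%:R^-1)%:E)%E.
  have thick_le i j : thick i j -> (p [set y | Z y i = j] <= (N%:R^-1)%:E)%E.
    move=> /asboolP[y [z [yz ky kz]]].
    rewrite (_ : [set _ | _] =
        [set v : d.-tuple R | coord_key N p i (tnth v i) = coord_key N p i y]).
      apply: (quantile_key_level _ N0 yz); last by rewrite -/(coord_key N p i y) ky -kz.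
      exact: measurable_tnth.
    apply/seteqP; split=> v /=; rewrite ffunE ky; first by move=> <-.
    by move=> kv; apply/val_inj.
  have N'0 : 0 <= N%:R^-1 :> R by rewrite invr_ge0.
  have := collision_le law_x indep (measurable_coord_key p h_gt) thick_le N'0.
  rewrite card_ord; congr (P _ <= _)%E; apply/funext => w /=; congr (is_true _).
  have zwE t : zw w t = Z (x t w) by rewrite [LHS]ffunE.
  by congr (collision _ _); apply/funext => t; rewrite -/Z zwE.
have bad_le zf : (uniform_seed R q.-1 (bad zf) <=
   ((T.+1 * (2 ^ (h * d) + 2 ^ (h * d * 2)) * 2)%:R * (2 ^ (b * tau))%N%:R^-1)%:E)%E.
  have sz : size (cells zf) = T by rewrite size_rev size_map size_enum_ord.
  rewrite uniform_seedE prednK // lee_fin ler_pdivrMr ?ltr0n //.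
  have V0R : 0 < V%:R :> R by rewrite ltr0n.
  have V_le : V%:R <= cc%:R :> R by rewrite ler_nat leq_pmulr // /b; nia.
  have th_v (z : cell h d) : exists i, forall j, @test_vec R h d i j = (box_vec z j)%:~R.
    by exists (inl z).
  have := unstable_count cc0 (fun _ _ => erefl) V0R V_le (@sqnorm_box_vec R h d)
    (@sqnorm_test_vec R h d) th_v (cells zf).
  rewrite sz card_test_vec (_ : cc%:R / (8 * V%:R) = (b * tau)%N%:R); last first.
    by rewrite /cc !natrM; field; rewrite pnatr_eq0 -lt0n.
  under [X in _ -> X <= _]eq_bigr do rewrite mem_setE.
  move=> /le_trans; apply.
  rewrite -/q; move: (b * tau)%N => e.
  rewrite !natrM -!mulrA ler_wpM2l // ler_wpM2l // ler_wpM2l //.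
  by rewrite mulrC ler_wpM2r // expRN_natr_le.
have Unst_le := seed_failure_le law_u law_x indep (measurable_quantize p h_gt)
  (fun zf => I : measurable (bad zf)) bad_le mUnst.
exists (~` (Coll `|` Unst)); split.
- by apply: measurableC; exact: measurableU.
- have Tc0 : 0 < T%:R ^+ c :> R by rewrite exprn_gt0 // ltr0n (leq_trans _ T2).
  have half_le (m n : nat) : (0 < n)%N -> (2 * T ^ c * m <= n)%N ->
      m%:R * n%:R^-1 <= (T%:R ^+ c)^-1 / 2 :> R.
    move=> n0 mn; rewrite -invfM -[leRHS]div1r ler_pdivrMr ?ltr0n // mulrAC mul1r.
    rewrite ler_pdivlMr ?mulr_gt0 // mulrC -natrX -!natrM ler_nat.
    by rewrite [(T ^ c * 2)%N]mulnC.
  have e1 := half_le _ _ N0 (@collision_budget T d c tau tau0 T_le).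
  have e2 := half_le _ _ _ (@stability_budget T (a * d) c tau tau0 T_le).
  have hd : (h * d = a * d * tau)%N by rewrite /h mulnAC.
  rewrite probability_setC; last exact: measurableU.
  rewrite EFinB leeB //; apply: (le_trans (measureU2 P mColl mUnst)).
  apply: (le_trans (leeD Coll_le Unst_le)).
  rewrite -EFinD lee_fin hd [leRHS](splitr); apply: lerD => //.
  by apply: e2; rewrite expn_gt0.
- move=> w nbad B boxB; set xs := [tuple x t w | t < T].
  have ncoll : ~~ coll (zw w) by apply/negP => cw; apply: nbad; left.
  have stab : stable cc (@kernel h d) (@box_vec h d) (@test_vec R h d) (u w)
      (rev (map Z xs)).
    have -> : rev (map Z xs) = cells (zw w).
      rewrite /cells -[in LHS](map_tnth_enum xs) -[in LHS]map_comp; congr rev.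
      by apply: eq_map => t /=; rewrite [RHS]ffunE tnth_mktuple.
    by apply: contrapT => ns; apply: nbad; right; apply/negP.
  have x_inj i s t : coord_key N p i (tnth (tnth xs s) i) =
      coord_key N p i (tnth (tnth xs t) i) -> tnth (tnth xs s) i = tnth (tnth xs t) i.
    rewrite !tnth_mktuple => kE; have [->//|st] := eqVneq s t.
    (* Distinct values with the same key would collide in a thick level. *)
    apply: contrapT => ne; move/negP: ncoll; apply.
    apply/existsP; exists (s, t, i); rewrite /= st /=.
    apply/existsP; exists (Z (x s w) i); rewrite !ffunE eqxx /=.
    apply/andP; split; last by apply/eqP/val_inj.
    apply/asboolP; rewrite /=.
    case: (ltgtP (tnth (x s w) i) (tnth (x t w) i)) => [lt|gt|//].
      by exists (tnth (x s w) i), (tnth (x t w) i).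
    by exists (tnth (x t w) i), (tnth (x s w) i).
  apply: (le_trans (max_disc_le x_inj boxB stab)).
  have tau_ln := @up_log_le_ln R T T2; rewrite -/tau in tau_ln.
  rewrite -mulrA -exprMn.
  apply: (@le_trans _ _ (((2 * a) ^ d * (8 * b))%N%:R * tau%:R ^+ (d + 4))); last first.
    by rewrite ler_wpM2l // lerXn2r ?nnegrE // (le_trans _ tau_ln).
  rewrite -natrX -natrM ler_nat /cc /V /h.
  have -> : ((2 * (a * tau)) ^ d * (8 * b * tau) =
      (2 * a) ^ d * (8 * b) * tau ^ d.+1)%N.
    by rewrite [(2 * (a * tau))%N]mulnA expnMn expnS; ring.
  (* The walk gives exponent [d + 1]; [tau >= 1] allows raising it to [d + 4]. *)
  by rewrite leq_mul // leq_pexp2l // addn4 ltnS; lia.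
Qed.
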